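(* Suppose $k\in L^2([0,1)\times[0,1))$ satisfies the Lipschitz condition with Lipschitz constant $L$. For $m=2^p$, $p=0,1,2,\dots$, and $h=1/m$, let $$k_m(x,y)=\sum_{i=0}^{m-1}\sum_{j=0}^{m-1}c_{ij}w_i(x)w_j(y),\qquad c_{ij}=\int_0^1\!\int_0^1 k(s,t)w_i(s)w_j(t)\,dt\,ds,$$ where $w_i$ is the $i$-th Walsh function. Then $\|e_m(x,y)\|_2=O(h)$, where $|e_m(x,y)|=|k(x,y)-k_m(x,y)|$.
   Context: $\|Y\|_2=E(|Y|^2)^{1/2}$ for a random variable $Y$. The Lipschitz condition means $|k(X)-k(T)|\le L|X-T|$ for $X,T\in[0,1)\times[0,1)$, with $|X-T|$ the Euclidean distance. Rademacher functions on $[0,1)$: $r_0=1$ and $r_i(t)=\operatorname{sgn}(\sin(2^i\pi t))$ for $i\ge1$, where $\operatorname{sgn}(u)$ is $1,0,-1$ for $u>0$, $u=0$, $u<0$ respectively. Walsh functions: $w_0=1$ and, for $n\ge1$ with binary expansion $n=b_q2^{q-1}+b_{q-1}2^{q-2}+\dots+b_12^0$ ($q=\lfloor\log_2 n\rfloor+1$), $w_n(t)=r_q(t)^{b_q}r_{q-1}(t)^{b_{q-1}}\cdots r_1(t)^{b_1}$. *)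

(* Defs.v *)
From HB Require Import structures.
From mathcomp Require Import all_boot all_order all_algebra.
From mathcomp Require Import all_classical all_reals all_analysis.

Set Implicit Arguments.
Unset Strict Implicit.
Unset Printing Implicit Defensive.
Import Order.TTheory GRing.Theory Num.Theory.
Import numFieldNormedType.Exports.

Local Open Scope classical_set_scope.
Local Open Scope ring_scope.

Definition rademacher {R : realType} (i : nat) (t : R) : R :=
  if i is 0%N then 1 else Num.sg (sin (2 ^+ i * pi * t)).

(* [bindigit n j] is b_j in n = \sum_(1 <= j <= q) b_j * 2 ^ (j - 1). *)
Definition bindigit (n j : nat) : bool := odd (n %/ 2 ^ j.-1).

Definition bindigits_count (n : nat) : nat := (trunc_log 2 n).+1.

(* As [Num.sg 0 = 0], a Walsh function of index n >= 1 vanishes at some dyadic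
   points; it is +1 or -1 only almost everywhere. *)
Definition walsh {R : realType} (n : nat) (t : R) : R :=
  if n is 0%N then 1
  else \prod_(1 <= j < (bindigits_count n).+1) rademacher j t ^+ bindigit n j.

Definition unit_square {R : realType} : set (R * R) :=
  `[0, 1[%classic `*` `[0, 1[%classic.

(* The norm that the library puts on [R * R] is the sup norm. *)
Definition euclidean_dist {R : realType} (X T : R * R) : R :=
  Num.sqrt ((X.1 - T.1) ^+ 2 + (X.2 - T.2) ^+ 2).

Definition lipschitz_square {R : realType} (L : R) (k : R * R -> R) : Prop :=
  forall X T, unit_square X -> unit_square T ->
    `|k X - k T| <= L * euclidean_dist X T.

(* Functions on the unit square are represented by total functions on [R * R]
   whose values outside of the square are irrelevant: they enter [L2_square] and
   the norm of the error only through this extension by 0. *)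
Definition on_square {R : realType} (f : R * R -> R) : R * R -> R :=
  patch (fun=> 0) unit_square f.

Definition L2_square {R : realType} (k : R * R -> R) : Prop :=
  on_square k \in Lfun (lebesgue_measure \x lebesgue_measure)%E 2%:E.

Definition walsh_coef {R : realType} (k : R * R -> R) (i j : nat) : R :=
  \int[lebesgue_measure]_(s in `[0, 1[) \int[lebesgue_measure]_(t in `[0, 1[)
    (k (s, t) * walsh i s * walsh j t).

Definition walsh_approx {R : realType} (k : R * R -> R) (m : nat) (z : R * R)
    : R :=
  \sum_(i < m) \sum_(j < m) walsh_coef k i j * walsh i z.1 * walsh j z.2.

Definition walsh_error {R : realType} (k : R * R -> R) (m : nat) (z : R * R)
    : R :=
  `|k z - walsh_approx k m z|.

Definition rv_norm2 {d : measure_display} {Omega : measurableType d}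
    {R : realType} (P : probability Omega R) (Y : Omega -> R) : \bar R :=
  ('E_P[fun w => (`|Y w| ^+ 2)%R] `^ 2^-1)%E.

(* The law of a pair (x, y) of independent uniform variables. It charges
   [0, 1] ^ 2 \ [0, 1[ ^ 2 with mass 0, so this is also Lebesgue measure on the
   half-open square. *)
Definition uniform_square (R : realType) :
    probability (measurableTypeR R * measurableTypeR R)%type R :=
  (uniform_prob (@ltr01 R) \x uniform_prob (@ltr01 R))%E.

(* Main.v *)
Require Import Defs.
From HB Require Import structures.
From mathcomp Require Import all_boot all_order all_algebra.
From mathcomp Require Import all_classical all_reals all_analysis.
From mathcomp Require Import measurable_realfun lra ring zify.
Import Order.TTheory GRing.Theory Num.Theory.
Import numFieldNormedType.Exports.
Local Open Scope classical_set_scope.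
Local Open Scope ring_scope.

(** The sum of [w_i x * w_i s] over [i < 2 ^ p] factors as the product of
    [1 + r_j x * r_j s] over [1 <= j <= p].  When neither [x] nor [s] is a
    multiple of [2 ^- p], the sign [r_j] reads off a binary digit of the point,
    so the product is [2 ^ p] if [x] and [s] lie in the same dyadic interval of
    length [2 ^- p] and [0] otherwise ([walsh_kernel_in_cell]).  Hence the
    truncated Walsh series of a function of one variable is, off a countable
    set, its mean over the dyadic interval containing the point
    ([walsh_sum_cell]), and it differs from a number [c] by no more than the
    function does on that interval ([walsh_sum_dist_le]).

    The double series [k_m] is the truncation in [t] followed by the truncation
    in [s] ([walsh_approx_iterated]).  A Lipschitz [k] varies by at most
    [`|L| * h] along each side of a dyadic square of side [h = 2 ^- p], so two
    uses of the one-variable estimate give [|k - k_m| <= 2 * `|L| * h] at every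
    point with no dyadic coordinate ([walsh_error_le]).  The excluded points
    form a null set for the uniform law, and an almost sure bound on a random
    variable bounds its quadratic norm ([rv_norm2_le]).

    The Lipschitz hypothesis also supplies the integrability needed to exchange
    the finite sums and the integrals: the integrands are all bounded and
    measurable on [0, 1[, a class stable under sums and products. *)

Set Implicit Arguments.
Unset Strict Implicit.
Unset Printing Implicit Defensive.

(** * The Walsh kernel on dyadic cells *)

Lemma sgr_sin_pi (R : realType) (n : nat) (u : R) :
  n%:R < u < n.+1%:R -> Num.sg (sin (pi * u)) = (-1) ^+ n.
Proof.
elim: n u => [|n ih] u /andP[nu un].
  rewrite expr0 gtr0_sg// sin_gt0_pi//.
  by rewrite mulr_gt0 ?pi_gt0//= gtr_pMr ?pi_gt0.
have -> : pi * u = pi * (u - 1) + pi by ring.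
rewrite sinDpi sgrN ih ?exprS ?mulN1r//.
by rewrite ltrBrDr ltrBlDr !natr1 nu.
Qed.

(** The end points of the dyadic interval are left out because Rademacher
    functions vanish there, and the kernel identity fails at some of them. *)
Definition in_cell {R : realType} (p n : nat) (t : R) : bool :=
  n%:R < 2 ^+ p * t < n.+1%:R.

(** Dropping the last binary digit of [n] gives the parent cell; this is what
    lets the kernel be computed by induction on [p]. *)
Lemma in_cell_half (R : realType) (p n : nat) (t : R) :
  in_cell p.+1 n t -> in_cell p n./2 t.
Proof.
rewrite /in_cell exprS -mulrA => /andP[nt tn].
have nE : n%:R = (odd n)%:R + 2 * n./2%:R :> R.
  by rewrite -{1}(odd_double_half n) natrD -mul2n natrM.
move: nt tn; rewrite -(natr1 n) nE -(natr1 n./2).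
move: (2 ^+ p * t) => v; case: (odd n) => /= ? ?; apply/andP; split; lra.
Qed.

(** [sin (pi * u)] changes sign at each integer [u], so the parity of the rank
    decides. *)
Lemma rademacher_in_cell (R : realType) (p n : nat) (t : R) :
  in_cell p.+1 n t -> rademacher p.+1 t = (-1) ^+ odd n.
Proof.
move=> /sgr_sin_pi; rewrite /rademacher signr_odd => <-; congr (Num.sg (sin _)).
by ring.
Qed.

(** Leading zero digits contribute trivial factors, so indices of different bit
    lengths can be compared with a common number [q] of digits. *)
Lemma walsh_digits (R : realType) (q n : nat) (t : R) : (n < 2 ^ q)%N ->
  walsh n t = \prod_(1 <= j < q.+1) rademacher j t ^+ bindigit n j.
Proof.
move=> nq; case: n nq => [|n] nq.
  by rewrite /= big1_seq// => j _; rewrite /bindigit div0n expr0.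
rewrite /walsh [RHS](@big_cat_nat _ _ _ (bindigits_count n.+1).+1)//=;
  last first.
  rewrite ltnS -(@ltn_exp2l 2)//.
  exact: leq_ltn_trans (trunc_logP _ _) nq.
rewrite [X in _ = _ * X]big1_seq ?mulr1// => j /andP[_].
rewrite mem_index_iota => /andP[nj jq].
rewrite /bindigit divn_small ?expr0//.
apply: (@leq_trans (2 ^ bindigits_count n.+1)%N); first exact: trunc_log_ltn.
by rewrite leq_exp2l//; case: j nj {jq}.
Qed.

Lemma walsh_add_pow (R : realType) (p i : nat) (t : R) : (i < 2 ^ p)%N ->
  walsh (2 ^ p + i) t = rademacher p.+1 t * walsh i t.
Proof.
move=> ip.
rewrite (@walsh_digits _ p.+1); last by rewrite expnS mul2n -addnn ltn_add2l.
rewrite (walsh_digits t ip) big_nat_recr//= mulrC; congr (_ * _).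
  by rewrite /bindigit /= divnDl// divnn expn_gt0/= divn_small// expr1.
apply: eq_big_nat => j /andP[j1 jp]; congr (_ ^+ (nat_of_bool _)).
rewrite /bindigit -(subnK (_ : (j.-1 <= p)%N)); last by lia.
rewrite expnD divnMDl ?expn_gt0// oddD oddX.
by have -> : (p - j.-1 == 0)%N = false by apply/eqP; lia.
Qed.

Definition walsh_kernel {R : realType} (m : nat) (x s : R) : R :=
  \sum_(i < m) walsh i x * walsh i s.

(** The indices below [2 ^ p.+1] are those below [2 ^ p] with a top digit 0 or
    1, and a top digit 1 multiplies the Walsh function by [r_(p+1)]. *)
Lemma walsh_kernel_double (R : realType) (p : nat) (x s : R) :
  walsh_kernel (2 ^ p.+1) x s =
  walsh_kernel (2 ^ p) x s * (1 + rademacher p.+1 x * rademacher p.+1 s).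
Proof.
pose r t : R := rademacher p.+1 t.
rewrite -!/(r _) /walsh_kernel expnS mul2n -addnn big_split_ord/= mulrDr mulr1.
congr (_ + _); rewrite mulr_suml; apply: eq_bigr => i _.
by rewrite !walsh_add_pow// /r; ring.
Qed.

(** If the parent cells differ the kernel already vanishes one level up; if they
    agree, the new factor [1 + r_(p+1) x * r_(p+1) s] is 2 or 0 according to
    whether the last digits of [n] and [n'] agree. *)
Lemma walsh_kernel_in_cell (R : realType) (p n n' : nat) (x s : R) :
  0 <= x < 1 -> 0 <= s < 1 -> in_cell p n x -> in_cell p n' s ->
  walsh_kernel (2 ^ p) x s = (n == n')%:R * 2 ^+ p.
Proof.
move=> x01 s01; elim: p n n' => [|p ih] n n' nx ns.
  have cell0 (y : R) k : 0 <= y < 1 -> in_cell 0 k y -> k = 0%N.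
    rewrite /in_cell expr0 mul1r => /andP[_ y1] /andP[ky _].
    by have := lt_trans ky y1; rewrite -[1]/(1%:R) ltr_nat; case: (k).
  rewrite (cell0 _ _ x01 nx) (cell0 _ _ s01 ns) /walsh_kernel expn0 big_ord1.
  by rewrite !mul1r.
rewrite walsh_kernel_double (ih n./2 n'./2) ?in_cell_half//.
rewrite (rademacher_in_cell nx) (rademacher_in_cell ns).
rewrite -signr_addb -[in RHS](odd_double_half n) -[in RHS](odd_double_half n').
rewrite exprS.
have [->|ne] := eqVneq n./2 n'./2.
  rewrite eqn_add2r; case: (odd n) (odd n') => -[] /=; ring.
suff -> : ((odd n + n./2.*2)%N == (odd n' + n'./2.*2)%N) = false
  by rewrite !mul0r.
apply/eqP => h; move/eqP: ne; apply; case: (odd n) (odd n') h => -[] /=; lia.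
Qed.

(** This grid contains every point of [0, 1[ that lies in no open cell of
    level [p]. *)
Definition dyadic {R : realType} (p : nat) : set R :=
  range (fun n : nat => n%:R / 2 ^+ p).

Lemma in_cell_exists (R : realType) (p : nat) (t : R) :
  0 <= t -> ~ dyadic p t -> exists n, in_cell p n t.
Proof.
move=> t0 nd; exists (Num.truncn (2 ^+ p * t)).
have p0 : 0 < 2 ^+ p :> R by rewrite exprn_gt0.
have : 0 <= 2 ^+ p * t by rewrite mulr_ge0// ltW.
move/truncn_itv => /andP[h1 h2]; rewrite /in_cell h2 andbT lt_neqAle h1 andbT.
apply/eqP => e; apply: nd; exists (Num.truncn (2 ^+ p * t)) => //.
by rewrite e mulrC mulKf ?gt_eqF.
Qed.

(** * Bounded measurable functions on the unit interval *)

Section bounded_measurable.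
Variable R : realType.
Implicit Types f g : R -> R.
Notation mu := (@lebesgue_measure R).
Notation I01 := (`[0%R, 1%R[%classic : set R).

(** A sufficient condition for integrability that, unlike integrability itself,
    is stable under products. *)
Definition bounded_measurable f : Prop :=
  measurable_fun I01 f /\ exists M, forall s, I01 s -> `|f s| <= M.

Lemma lebesgue_measure_I01 : mu I01 = 1%E.
Proof. by rewrite lebesgue_measure_itv/= lte_fin ltr01 oppr0 adde0. Qed.

Lemma bounded_measurable_integrable f :
  bounded_measurable f -> mu.-integrable I01 (EFin \o f).
Proof.
move=> [mf [M fM]]; apply: measurable_bounded_integrable => //.
  by rewrite [X in (X < _)%E]lebesgue_measure_I01 ltry.
have F : ProperFilter (globally I01).
  by apply: (@globally_properfilter _ _ 0); rewrite /= in_itv/= lexx ltr01.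
by apply/ex_bound; exists M.
Qed.

Lemma bounded_measurableM f g : bounded_measurable f -> bounded_measurable g ->
  bounded_measurable (fun s => f s * g s).
Proof.
move=> [mf [M fM]] [mg [N gN]]; split; first exact: measurable_funM.
by exists (M * N) => s s01; rewrite normrM ler_pM// ?fM ?gN.
Qed.

Lemma bounded_measurableD f g : bounded_measurable f -> bounded_measurable g ->
  bounded_measurable (fun s => f s + g s).
Proof.
move=> [mf [M fM]] [mg [N gN]]; split; first exact: measurable_funD.
exists (M + N) => s s01; apply: le_trans (ler_normD _ _) _.
by rewrite lerD ?fM ?gN.
Qed.

Lemma bounded_measurable_cst (c : R) : bounded_measurable (fun=> c).
Proof. by split; [exact: measurable_cst|exists `|c|]. Qed.

Lemma bounded_measurable_sum (m : nat) (F : 'I_m -> R -> R) :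
  (forall i, bounded_measurable (F i)) ->
  bounded_measurable (fun s => \sum_(i < m) F i s).
Proof.
elim: m F => [|m ih] F bF.
  under eq_fun do rewrite big_ord0; exact: bounded_measurable_cst.
under eq_fun do rewrite big_ord_recr/=.
by apply: bounded_measurableD => //; apply: ih.
Qed.

Lemma Rintegral_sum01 (m : nat) (F : 'I_m -> R -> R) :
  (forall i, bounded_measurable (F i)) ->
  \int[mu]_(s in I01) (\sum_(i < m) F i s) =
  \sum_(i < m) \int[mu]_(s in I01) F i s.
Proof.
elim: m F => [|m ih] F bF.
  under eq_Rintegral do rewrite big_ord0.
  by rewrite big_ord0 Rintegral_cst// mul0r.
under eq_Rintegral do rewrite big_ord_recr/=.
rewrite big_ord_recr/= RintegralD ?ih//; apply: bounded_measurable_integrable.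
  exact: bounded_measurable_sum.
exact: bF.
Qed.

Lemma bounded_measurable_lipschitz (K : R) f :
  (forall s t, I01 s -> I01 t -> `|f s - f t| <= K * `|s - t|) ->
  bounded_measurable f.
Proof.
move=> fK; have I0 : I01 0 by rewrite /= in_itv/= lexx ltr01.
split.
  apply: subspace_continuous_measurable_fun => //.
  apply/subspace_continuousP => s s01; apply/cvgrPdist_le => e e0.
  have d0 : 0 < e / (`|K| + 1) by rewrite divr_gt0// ltr_wpDl.
  (* adding 1 to the constant keeps the divisor nonzero when it is 0 *)
  rewrite near_withinE; near=> t => t01.
  apply: le_trans (fK _ _ s01 t01) _.
  have st : `|s - t| <= e / (`|K| + 1) by near: t; exact: cvgr_dist_le.
  rewrite -[leRHS](divfK (_ : `|K| + 1 != 0));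
    last by rewrite gt_eqF// ltr_wpDl.
  rewrite mulrC; apply: le_trans (_ : `|s - t| * (`|K| + 1) <= _).
    by rewrite ler_wpM2l// (le_trans (ler_norm _))// lerDl.
  by rewrite ler_wpM2r// addr_ge0.
exists (`|f 0| + `|K|) => s s01.
rewrite -[f s](subrK (f 0)) addrC; apply: le_trans (ler_normD _ _) _.
rewrite lerD2l (le_trans (fK _ _ s01 I0))// subr0.
apply: le_trans (ler_norm _) _; rewrite normrM normr_id ler_piMr//.
by move: s01; rewrite /= in_itv/= => /andP[s0 s1]; rewrite ger0_norm// ltW.
Unshelve. all: by end_near. Qed.

Lemma normr_Rintegral01_le f (M : R) : bounded_measurable f ->
  (forall s, I01 s -> `|f s| <= M) -> `|\int[mu]_(s in I01) f s| <= M.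
Proof.
move=> bf fM; have intf := bounded_measurable_integrable bf.
apply: le_trans (le_normr_Rintegral _ intf) _ => //.
apply: (@le_trans _ _ (\int[mu]_(s in I01) M)).
  apply: le_Rintegral => //.
    exact: (integrable_norm intf).
  exact/bounded_measurable_integrable/bounded_measurable_cst.
rewrite Rintegral_cst//.
by rewrite [X in fine X]lebesgue_measure_I01 mulr1.
Qed.

Lemma bounded_measurable_sg_sin (c : R) :
  bounded_measurable (fun t => Num.sg (sin (c * t))).
Proof.
have sgE (x : R) : Num.sg x = if 0 < x then 1 else if x < 0 then -1 else 0.
  by rewrite /Num.sg; case: ltgtP.
split; last by exists 1 => s _; rewrite normr_sg; case: (_ != 0).
apply: measurable_funTS.
have ms : measurable_fun setT (fun t : R => sin (c * t)).
  apply: (measurableT_comp (continuous_measurable_fun (@continuous_sin R))).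
  exact: measurable_funM.
under eq_fun do rewrite sgE.
apply: measurable_fun_ifT => //; first exact: measurable_fun_ltr.
by apply: measurable_fun_ifT => //; exact: measurable_fun_ltr.
Qed.

Lemma bounded_measurable_walsh (n : nat) : bounded_measurable (walsh n).
Proof.
case: n => [|n]; first exact: bounded_measurable_cst.
rewrite (_ : walsh n.+1 = fun t => \prod_(1 <= j < (bindigits_count n.+1).+1)
  rademacher j t ^+ bindigit n.+1 j)//.
elim: (index_iota _ _) => [|j s ih].
  by under eq_fun do rewrite big_nil; exact: bounded_measurable_cst.
under eq_fun do rewrite big_cons.
apply: bounded_measurableM => //.
case: (bindigit _ _); last first.
  by under eq_fun do rewrite expr0; exact: bounded_measurable_cst.
under eq_fun do rewrite expr1.
case: j => [|j]; first exact: bounded_measurable_cst.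
exact: bounded_measurable_sg_sin.
Qed.

Lemma normr_walsh_le1 (n : nat) (t : R) : `|walsh n t| <= 1.
Proof.
case: n => [|n]; first by rewrite normr1.
rewrite normr_prod; apply: prodr_ile1 => j _; rewrite normr_ge0/= normrX.
case: (bindigit _ _); rewrite ?expr0// expr1.
by case: j => [|j]; rewrite ?normr1// normr_sg; case: (_ != 0).
Qed.

End bounded_measurable.

(** * Truncated Walsh series in one variable *)

Section walsh_sum.
Variable R : realType.
Implicit Types f g : R -> R.
Notation mu := (@lebesgue_measure R).
Notation I01 := (`[0%R, 1%R[%classic : set R).

Lemma dyadic_null (p : nat) :
  measurable (dyadic p : set R) /\ mu (dyadic p) = 0%E.
Proof.
have cd : countable (dyadic p : set R).
  by apply: card_image_le.
by split; [exact: countable_measurable | exact: countable_lebesgue_measure0].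
Qed.

Definition walsh_sum (p : nat) f (x : R) : R :=
  \sum_(i < 2 ^ p) (\int[mu]_(s in I01) (f s * walsh i s)) * walsh i x.

Lemma bounded_measurable_walsh_kernel (m : nat) (x : R) :
  bounded_measurable (walsh_kernel m x).
Proof.
apply: bounded_measurable_sum => i; apply: bounded_measurableM.
  exact: bounded_measurable_cst.
exact: bounded_measurable_walsh.
Qed.

Lemma walsh_sum_kernel (p : nat) f (x : R) : bounded_measurable f ->
  walsh_sum p f x = \int[mu]_(s in I01) (f s * walsh_kernel (2 ^ p) x s).
Proof.
move=> bf.
have bfw i : bounded_measurable (fun s => f s * walsh i s).
  by apply: bounded_measurableM => //; exact: bounded_measurable_walsh.
transitivity (\int[mu]_(s in I01)
    \sum_(i < 2 ^ p) (f s * walsh i s * walsh i x)).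
  rewrite Rintegral_sum01.
    apply: eq_bigr => i _; rewrite RintegralZr//.
    exact: bounded_measurable_integrable.
  by move=> i; apply: bounded_measurableM => //; exact: bounded_measurable_cst.
apply: eq_Rintegral => s _; rewrite /walsh_kernel mulr_sumr.
by apply: eq_bigr => i _; ring.
Qed.

Lemma in_cell_itv (p n : nat) :
  [set s : R | in_cell p n s] =
  `](n%:R / 2 ^+ p), (n.+1%:R / 2 ^+ p)[%classic.
Proof.
apply/seteqP; split => s; rewrite /= in_itv/= /in_cell;
  by rewrite ltr_pdivrMr ?ltr_pdivlMr ?exprn_gt0// [s * _]mulrC.
Qed.

Lemma lebesgue_measure_in_cell (p n : nat) :
  mu [set s : R | in_cell p n s] = (2 ^- p)%:E.
Proof.
rewrite in_cell_itv lebesgue_measure_itv/= lte_fin.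
rewrite ltr_pM2r ?invr_gt0 ?exprn_gt0// ltr_nat leqnn -EFinD.
by rewrite -mulrBl -natrB// subSnn mul1r.
Qed.

Lemma in_cell_sub01 (p n : nat) (x : R) : x < 1 -> in_cell p n x ->
  [set s : R | in_cell p n s] `<=` I01.
Proof.
move=> x1 /andP[nx _] s /= /andP[ns sn]; rewrite in_itv/=.
have p0 : 0 < 2 ^+ p :> R by rewrite exprn_gt0.
have np : n.+1%:R <= 2 ^+ p :> R.
  rewrite -natrX ler_nat -(ltr_nat R) natrX; apply: lt_trans nx _.
  by rewrite gtr_pMr.
apply/andP; split.
  by rewrite -(pmulr_rge0 _ p0) ltW// (le_lt_trans _ ns).
by rewrite -(ltr_pM2l p0) mulr1 (lt_le_trans sn).
Qed.

(** The kernel is [2 ^ p] on the cell of [x] and vanishes on the other cells,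
    and the points outside of all cells form a null set. *)
Lemma walsh_sum_cell (p n : nat) f (x : R) : bounded_measurable f ->
  0 <= x < 1 -> in_cell p n x ->
  walsh_sum p f x =
  \int[mu]_(s in [set s | in_cell p n s]) (f s * 2 ^+ p).
Proof.
move=> bf x01 nx; have C01 := in_cell_sub01 (andP x01).2 nx.
have mC : measurable [set s : R | in_cell p n s] by rewrite in_cell_itv.
have bfp : bounded_measurable (fun s => f s * 2 ^+ p).
  by apply: bounded_measurableM => //; exact: bounded_measurable_cst.
rewrite walsh_sum_kernel// -[in RHS](setIidr C01) Rintegral_mkcondr.
rewrite /Rintegral; congr fine; apply: ae_eq_integral => //.
- apply/measurable_EFinP.
  exact: (bounded_measurableM bf (bounded_measurable_walsh_kernel _ _)).1.
- apply/measurable_EFinP/measurable_restrict => //.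
  by apply: measurable_funS bfp.1.
have [md d0] := dyadic_null p.
exists (dyadic p); split => //= s /= neq; apply: contrapT => nd.
apply: neq => s01.
have s01' : 0 <= s < 1 by move: s01; rewrite in_itv.
have [n' ns] := in_cell_exists (andP s01').1 nd.
rewrite (walsh_kernel_in_cell x01 s01' nx ns) patchE; congr EFin.
have [->|nn'] := eqVneq n n'; first by rewrite mul1r mem_set.
rewrite mul0r mulr0 memNset//= => ns'; move/eqP: nn'; apply.
(* distinct cells are disjoint *)
have h (a b : nat) : in_cell p a s -> in_cell p b s -> (a <= b)%N.
  rewrite -ltnS -(ltr_nat R) => /andP[as_ _] /andP[_ sb].
  exact: lt_trans as_ sb.
by apply/eqP; rewrite eqn_leq !h.
Qed.

(** A mean of [f] over the cell lies between [c - B] and [c + B] as soon as [f]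
    does there. *)
Lemma walsh_sum_dist_le (p n : nat) f (x c B : R) : bounded_measurable f ->
  0 <= x < 1 -> in_cell p n x ->
  (forall s, I01 s -> in_cell p n s -> `|f s - c| <= B) ->
  `|walsh_sum p f x - c| <= B.
Proof.
move=> bf x01 nx fB; have C01 := in_cell_sub01 (andP x01).2 nx.
have mC : measurable [set s : R | in_cell p n s] by rewrite in_cell_itv.
have icst (r : R) : mu.-integrable [set s : R | in_cell p n s] (EFin \o cst r).
  by apply: (@integrableS _ _ _ mu I01) => //;
    exact/bounded_measurable_integrable/bounded_measurable_cst.
have if_ : mu.-integrable [set s : R | in_cell p n s]
    (EFin \o (fun s => f s * 2 ^+ p)).
  apply: (@integrableS _ _ _ mu I01) => //.
  apply: bounded_measurable_integrable.
  by apply: bounded_measurableM => //; exact: bounded_measurable_cst.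
(* the cell has measure [2 ^- p], so the truncation reproduces constants *)
have Icst (r : R) :
    \int[mu]_(s in [set s : R | in_cell p n s]) (r * 2 ^+ p) = r.
  rewrite Rintegral_cst// [X in fine X]lebesgue_measure_in_cell/=.
  by rewrite mulfK// gt_eqF// exprn_gt0.
rewrite (walsh_sum_cell bf x01 nx) ler_distl.
rewrite -[X in X <= _](Icst (c - B)) -[X in _ && (_ <= X)](Icst (c + B)).
apply/andP; split; apply: le_Rintegral => //;
  (try exact: icst) => s ns;
  rewrite ler_pM2r ?exprn_gt0//; move: (fB s (C01 _ ns) ns);
  by rewrite ler_distl => /andP[].
Qed.

End walsh_sum.

(** * The pointwise error of the double Walsh series *)

Section walsh_approx.
Variables (R : realType) (L : R) (k : R * R -> R).
Hypothesis k_lip : lipschitz_square L k.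
Notation mu := (@lebesgue_measure R).
Notation I01 := (`[0%R, 1%R[%classic : set R).

Lemma lipschitz_square_fst (s s' t : R) : I01 s -> I01 s' -> I01 t ->
  `|k (s, t) - k (s', t)| <= `|L| * `|s - s'|.
Proof.
move=> s01 s01' t01.
have st r : I01 r -> unit_square (r, t) by [].
apply: le_trans (k_lip (st _ s01) (st _ s01')) _.
rewrite /euclidean_dist/= subrr expr0n addr0 sqrtr_sqr.
by rewrite ler_wpM2r// ler_norm.
Qed.

Lemma lipschitz_square_snd (s t t' : R) : I01 s -> I01 t -> I01 t' ->
  `|k (s, t) - k (s, t')| <= `|L| * `|t - t'|.
Proof.
move=> s01 t01 t01'.
have st r : I01 r -> unit_square (s, r) by [].
apply: le_trans (k_lip (st _ t01) (st _ t01')) _.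
rewrite /euclidean_dist/= subrr expr0n add0r sqrtr_sqr.
by rewrite ler_wpM2r// ler_norm.
Qed.

Lemma bounded_measurable_section_walsh (j : nat) (s : R) : I01 s ->
  bounded_measurable (fun t => k (s, t) * walsh j t).
Proof.
move=> s01; apply: bounded_measurableM; last exact: bounded_measurable_walsh.
by apply: (@bounded_measurable_lipschitz _ `|L|) => t t' *;
  exact: lipschitz_square_snd.
Qed.

(** Integrating against [w_j] over an interval of length 1 preserves the
    Lipschitz constant in [s], because [|w_j| <= 1]. *)
Lemma bounded_measurable_section_coef (j : nat) :
  bounded_measurable (fun s => \int[mu]_(t in I01) (k (s, t) * walsh j t)).
Proof.
apply: (@bounded_measurable_lipschitz _ `|L|) => s s' s01 s01'.
have int r : I01 r ->
    mu.-integrable I01 (EFin \o (fun t => k (r, t) * walsh j t)).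
  move=> r01; apply: bounded_measurable_integrable.
  exact: bounded_measurable_section_walsh.
rewrite -RintegralB ?int//; apply: normr_Rintegral01_le.
  have := bounded_measurableM (bounded_measurable_cst (-1))
    (bounded_measurable_section_walsh j s01').
  move/(bounded_measurableD (bounded_measurable_section_walsh j s01)).
  by under eq_fun do rewrite mulN1r.
move=> t t01; rewrite -mulrBl normrM.
apply: le_trans (ler_piMr _ (normr_walsh_le1 _ _)) _ => //.
exact: lipschitz_square_fst.
Qed.

Lemma walsh_coefE (i j : nat) : walsh_coef k i j =
  \int[mu]_(s in I01)
    ((\int[mu]_(t in I01) (k (s, t) * walsh j t)) * walsh i s).
Proof.
apply: eq_Rintegral => s /set_mem s01; rewrite -RintegralZr//.
  by apply: eq_Rintegral => t _; rewrite mulrAC.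
exact/bounded_measurable_integrable/bounded_measurable_section_walsh.
Qed.

Lemma walsh_approx_iterated (p : nat) (z : R * R) :
  walsh_approx k (2 ^ p) z =
  walsh_sum p (fun s => walsh_sum p (fun t => k (s, t)) z.2) z.1.
Proof.
apply: eq_bigr => i _; rewrite {1}/walsh_sum.
under [in RHS]eq_Rintegral do rewrite mulr_suml.
rewrite Rintegral_sum01; last first.
  move=> j; apply: bounded_measurableM; last exact: bounded_measurable_walsh.
  apply: bounded_measurableM; last exact: bounded_measurable_cst.
  exact: bounded_measurable_section_coef.
rewrite mulr_suml; apply: eq_bigr => j _.
under [in RHS]eq_Rintegral do rewrite mulrAC.
rewrite RintegralZr//; first by rewrite walsh_coefE mulrAC.
apply/bounded_measurable_integrable/bounded_measurableM.
  exact: bounded_measurable_section_coef.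
exact: bounded_measurable_walsh.
Qed.

Lemma in_cell_dist (p n : nat) (s t : R) :
  in_cell p n s -> in_cell p n t -> `|s - t| <= 2 ^- p.
Proof.
move=> /andP[ns sn] /andP[nt tn].
have p0 : 0 < 2 ^+ p :> R by rewrite exprn_gt0.
rewrite -(ler_pM2l p0) divff ?gt_eqF// -[X in X * `|_|]gtr0_norm// -normrM.
rewrite mulrBr ler_norml; move: ns sn nt tn; rewrite -natr1.
by move=> *; apply/andP; split; lra.
Qed.

(** For [t] in the cell of [z.2], [k (s, t)] is within [`|L| * 2 ^- p] of
    [k (s, z.2)], hence so is the inner truncation; moving [s] in the cell of
    [z.1] costs the same amount again. *)
Lemma walsh_error_le (p a b : nat) (z : R * R) : unit_square z ->
  in_cell p a z.1 -> in_cell p b z.2 ->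
  walsh_error k (2 ^ p) z <= 2 * `|L| * 2 ^- p.
Proof.
case: z => x y [/= x01 y01] ax b_y.
rewrite /walsh_error walsh_approx_iterated distrC /=.
have x01' : 0 <= x < 1 by move: x01; rewrite in_itv.
have y01' : 0 <= y < 1 by move: y01; rewrite in_itv.
apply: (walsh_sum_dist_le _ _ ax) => //.
  apply: bounded_measurable_sum => j; apply: bounded_measurableM.
    exact: bounded_measurable_section_coef.
  exact: bounded_measurable_cst.
move=> s s01 a_s.
have -> : 2 * `|L| * 2 ^- p = `|L| * 2 ^- p + `|L| * 2 ^- p by ring.
rewrite -(subrKA (k (s, y))); apply: le_trans (ler_normD _ _) (lerD _ _).
  apply: (walsh_sum_dist_le _ _ b_y) => //.
    by apply: (@bounded_measurable_lipschitz _ `|L|) => t t' *;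
      exact: lipschitz_square_snd.
  move=> t t01 b_t; apply: le_trans (lipschitz_square_snd s01 t01 y01) _.
  by rewrite ler_wpM2l// (in_cell_dist b_t b_y).
apply: le_trans (lipschitz_square_fst s01 x01 y01) _.
by rewrite ler_wpM2l// (in_cell_dist a_s ax).
Qed.

End walsh_approx.

(** * From almost sure bounds to the quadratic norm *)

Lemma measurable_unit_square (R : realType) :
  measurable (unit_square : set (measurableTypeR R * measurableTypeR R)).
Proof. exact: measurableX. Qed.

Lemma measurable_walsh_error (R : realType) (k : R * R -> R) (m : nat) :
  L2_square k ->
  measurable_fun setT
    (on_square (walsh_error k m) : measurableTypeR R * measurableTypeR R -> R).
Proof.
move=> /andP[kL _]; have mk : measurable_fun setT (on_square k).
  by move: kL; rewrite inE.
have mS := @measurable_unit_square R.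
apply/(measurable_restrictT _ mS); move/(measurable_restrictT _ mS): mk => mk.
apply: measurableT_comp => //; apply: measurable_funB => //.
(* [walsh i] is known to be measurable on [0, 1[, hence the restriction to the
   square before composing with the projections *)
have mw1 i : measurable_fun (@unit_square R) (fun z => walsh i z.1).
  apply: (@measurable_comp _ _ _ _ (measurableTypeR R) (measurableTypeR R)
    `[0%R, 1%R[%classic (walsh i)) => //.
  - by move=> _ [z [z1 _] <-].
  - exact: (bounded_measurable_walsh R i).1.
  - exact: measurable_funTS.
have mw2 i : measurable_fun (@unit_square R) (fun z => walsh i z.2).
  apply: (@measurable_comp _ _ _ _ (measurableTypeR R) (measurableTypeR R)
    `[0%R, 1%R[%classic (walsh i)) => //.
  - by move=> _ [z [_ z2] <-].
  - exact: (bounded_measurable_walsh R i).1.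
  - exact: measurable_funTS.
apply: measurable_sum => i; apply: measurable_sum => j.
apply: measurable_funM; last exact: mw2.
by apply: measurable_funM; last exact: mw1.
Qed.

Lemma uniform_square_dyadic_null (R : realType) (p : nat) :
  (uniform_square R).-negligible [set z | dyadic p z.1 \/ dyadic p z.2].
Proof.
have [md d0] := @dyadic_null R p.
have u0 : uniform_prob (@ltr01 R) (dyadic p) = 0%E.
  by move/null_content_dominatesP: (@dominates_uniform_prob R _ _ ltr01); apply.
have -> : [set z : R * R | dyadic p z.1 \/ dyadic p z.2] =
    (dyadic p `*` setT) `|` (setT `*` dyadic p).
  by apply/seteqP; split => z /=; tauto.
apply: negligibleU.
  exists (dyadic p `*` setT); split => //; first exact: measurableX.
  by rewrite [LHS]product_measure1E// [X in (X * _)%E]u0 mul0e.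
exists (setT `*` dyadic p); split => //; first exact: measurableX.
by rewrite [LHS]product_measure1E// [X in (_ * X)%E]u0 mule0.
Qed.

Lemma rv_norm2_le (d : measure_display) (T : measurableType d) (R : realType)
    (P : probability T R) (Y : T -> R) (B : R) : 0 <= B ->
  measurable_fun setT Y -> {ae P, forall w, `|Y w| <= B} ->
  (rv_norm2 P Y <= B%:E)%E.
Proof.
move=> B0 mY YB; rewrite /rv_norm2.
suff EB : ('E_P[fun w => (`|Y w| ^+ 2)%R] <= (B ^+ 2)%:E)%E.
  have -> : B%:E = ((B ^+ 2)%:E `^ 2^-1)%E.
    by rewrite poweR_EFin powR12_sqrt ?exprn_ge0// sqrtr_sqr ger0_norm.
  apply: gt0_ler_poweR => //;
    rewrite ?in_itv/= ?leey ?andbT ?lee_fin ?exprn_ge0//.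
  by apply: expectation_ge0 => w; rewrite exprn_ge0.
rewrite unlock.
have -> : (B ^+ 2)%:E = (\int[P]_w (cst (B ^+ 2)%:E w))%E.
  by rewrite integral_cst// [X in (_ * X)%E]probability_setT mule1.
apply: ae_ge0_le_integral => //.
  by apply/measurable_EFinP/measurable_funX; exact: measurableT_comp.
  by move=> w _; rewrite lee_fin exprn_ge0.
apply: (filterS _ YB) => w YwB _.
by rewrite lee_fin ler_pXn2r// nnegrE.
Qed.

Unset Implicit Arguments.

Theorem theorem5p2 (R : realType) (k : R * R -> R) (L : R)
    (k_L2 : L2_square k) (k_lip : lipschitz_square L k) :
  exists C : R, forall (p m : nat) (h : R),
    m = (2 ^ p)%N -> h = m%:R^-1 ->
    (rv_norm2 (uniform_square R) (on_square (walsh_error k m))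
       <= (C * h)%:E)%E.
Proof.
exists (2 * `|L|) => p m h -> ->; rewrite natrX.
have B0 : 0 <= 2 * `|L| * 2 ^- p by rewrite !mulr_ge0// invr_ge0 exprn_ge0.
apply: rv_norm2_le => //; first exact: measurable_walsh_error.
apply: negligibleS (@uniform_square_dyadic_null R p) => z /= zB.
apply: contrapT => nd; apply: zB; rewrite /on_square patchE.
case: ifPn => [/set_mem zS|_]; last by rewrite normr0.
have [z1 z2] := zS.
have z10 : 0 <= z.1 by move: z1; rewrite /= in_itv/= => /andP[].
have z20 : 0 <= z.2 by move: z2; rewrite /= in_itv/= => /andP[].
have [a az] := in_cell_exists z10 (fun d => nd (or_introl d)).
have [b bz] := in_cell_exists z20 (fun d => nd (or_intror d)).
by rewrite ger0_norm ?(walsh_error_le k_lip zS az bz)// normr_ge0.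
Qed.
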